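(* Let $\hat A \in \mathbb{R}^{m\times n}$, $\hat b\in\mathbb{R}^m$, $\hat c\in\mathbb{R}^n$. Let $\mathcal{U}\subseteq\mathbb{R}^m\times\mathbb{R}^n$ be compact and convex with $(0,0)\in\mathcal{U}$, and assume that $P(0)$ and $D(0)$ are both nonempty and that one of them is bounded. Define $$p^-:=\inf\{p(b,c):(b,c)\in\mathcal{U}\},\qquad p^+:=\sup\{p(b,c):(b,c)\in\mathcal{U}\},$$ $$q^-:=\inf\{p(b,c):(b,c)\in\overline{\mathcal{U}}\},\qquad q^+:=\sup\{p(b,c):(b,c)\in\overline{\mathcal{U}}\}.$$ If $p^+$ is finite, then $q^+=p^+$; and if $p^-$ is finite, then $q^-=p^-$.
   Context: For $(b,c)\in\mathcal{U}$, the perturbed optimal value is $p(b,c):=\min\{(\hat c+c)^Tx:\hat Ax=\hat b+b,\ x\ge0\}$, understood as an extended real number ($+\infty$ if infeasible, $-\infty$ if unbounded below). The perturbed primal and dual feasible sets are $P(b):=\{x\in\mathbb{R}^n:\hat Ax=\hat b+b,\ x\ge0\}$ and $D(c):=\{(y,s)\in\mathbb{R}^m\times\mathbb{R}^n:\hat A^Ty+s=\hat c+c,\ s\ge0\}$. The restricted uncertainty set is $\overline{\mathcal{U}}:=\{(b,c)\in\mathcal{U}:P(b)\neq\emptyset,\ D(c)\neq\emptyset\}$. *)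

(* Defs.v *)
From mathcomp Require Import all_boot all_order all_algebra.
From mathcomp Require Import all_classical all_reals all_analysis.
Set Implicit Arguments.
Unset Strict Implicit.
Unset Printing Implicit Defensive.
Import Order.TTheory GRing.Theory Num.Theory.
Import numFieldNormedType.Exports.
Local Open Scope classical_set_scope.
Local Open Scope ring_scope.

Definition nonneg (R : realType) (n : nat) (x : 'cV[R]_n) : Prop :=
  forall i, 0 <= x i 0.

Definition primal_feasible (R : realType) (m n : nat) (A : 'M[R]_(m, n))
    (bhat b : 'cV[R]_m) : set 'cV[R]_n :=
  [set x | A *m x = bhat + b /\ nonneg x].

Definition dual_feasible (R : realType) (m n : nat) (A : 'M[R]_(m, n))
    (chat c : 'cV[R]_n) : set ('cV[R]_m * 'cV[R]_n) :=
  [set ys | A^T *m ys.1 + ys.2 = chat + c /\ nonneg ys.2].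

Definition objective (R : realType) (n : nat) (chat c x : 'cV[R]_n) : R :=
  ((chat + c)^T *m x) 0 0.

(* The minimum is taken in \bar R as an infimum: it is +oo on the empty
   feasible set, -oo when the objective is unbounded below, and the minimum
   whenever the latter is attained (see the three lemmas below). *)
Definition opt_value (R : realType) (m n : nat) (A : 'M[R]_(m, n))
    (bhat : 'cV[R]_m) (chat : 'cV[R]_n) (b : 'cV[R]_m) (c : 'cV[R]_n) : \bar R :=
  ereal_inf [set (objective chat c x)%:E | x in primal_feasible A bhat b].

Lemma opt_value_infeasible (R : realType) (m n : nat) (A : 'M[R]_(m, n))
    (bhat : 'cV[R]_m) (chat : 'cV[R]_n) (b : 'cV[R]_m) (c : 'cV[R]_n) :
  primal_feasible A bhat b = set0 -> opt_value A bhat chat b c = +oo%E.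
Proof. by move=> P0; rewrite /opt_value P0 image_set0 ereal_inf0. Qed.

Lemma opt_value_unbounded (R : realType) (m n : nat) (A : 'M[R]_(m, n))
    (bhat : 'cV[R]_m) (chat : 'cV[R]_n) (b : 'cV[R]_m) (c : 'cV[R]_n) :
  (forall M : R, exists2 x, primal_feasible A bhat b x &
    objective chat c x < M) ->
  opt_value A bhat chat b c = -oo%E.
Proof.
move=> unbd; case p_eq : (opt_value A bhat chat b c) => [r| |] //.
- have [x Px xr] := unbd r.
  have : (opt_value A bhat chat b c <= (objective chat c x)%:E)%E.
    by apply: ereal_inf_lbound; exists x.
  by rewrite p_eq lee_fin leNgt xr.
- have [x Px _] := unbd 0.
  have : (opt_value A bhat chat b c <= (objective chat c x)%:E)%E.
    by apply: ereal_inf_lbound; exists x.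
  by rewrite p_eq leye_eq.
Qed.

Lemma opt_value_min (R : realType) (m n : nat) (A : 'M[R]_(m, n))
    (bhat : 'cV[R]_m) (chat : 'cV[R]_n) (b : 'cV[R]_m) (c x : 'cV[R]_n) :
  primal_feasible A bhat b x ->
  (forall z, primal_feasible A bhat b z ->
    objective chat c x <= objective chat c z) ->
  opt_value A bhat chat b c = (objective chat c x)%:E.
Proof.
move=> Px xmin; apply/eqP; rewrite eq_le; apply/andP; split.
  by apply: ereal_inf_lbound; exists x.
by apply: le_ereal_inf_tmp => _ [z Pz <-]; rewrite lee_fin; exact: xmin.
Qed.

Definition restricted_uncertainty (R : realType) (m n : nat)
    (A : 'M[R]_(m, n)) (bhat : 'cV[R]_m) (chat : 'cV[R]_n)
    (U : set ('cV[R]_m * 'cV[R]_n)) : set ('cV[R]_m * 'cV[R]_n) :=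
  [set bc | [/\ U bc, primal_feasible A bhat bc.1 !=set0
                    & dual_feasible A chat bc.2 !=set0]].

Definition inf_opt_value (R : realType) (m n : nat) (A : 'M[R]_(m, n))
    (bhat : 'cV[R]_m) (chat : 'cV[R]_n) (S : set ('cV[R]_m * 'cV[R]_n)) : \bar R :=
  ereal_inf [set opt_value A bhat chat bc.1 bc.2 | bc in S].

Definition sup_opt_value (R : realType) (m n : nat) (A : 'M[R]_(m, n))
    (bhat : 'cV[R]_m) (chat : 'cV[R]_n) (S : set ('cV[R]_m * 'cV[R]_n)) : \bar R :=
  ereal_sup [set opt_value A bhat chat bc.1 bc.2 | bc in S].

(* Main.v *)
Require Import Defs.
From mathcomp Require Import all_boot all_order all_algebra.
From mathcomp Require Import all_classical all_reals all_analysis.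
From mathcomp Require Import lra.
Import Order.TTheory GRing.Theory Num.Theory.
Import numFieldNormedType.Exports.
Local Open Scope classical_set_scope.
Local Open Scope ring_scope.

(** Restricting the uncertainty set to the pairs [(b, c)] for which both
    programs are feasible discards two kinds of pairs.  If the primal is
    infeasible, the value is [+oo]; if the primal is feasible but the dual is
    not, then by LP duality the value is [-oo] ([opt_value_dual_infeasible]).
    A finite supremum rules out the first kind and is insensitive to the
    second; a finite infimum rules out the second kind and is insensitive to
    the first.

    The duality input is Farkas' lemma ([farkas]): when [A^T y + s = c] has no
    solution with [s >= 0], some [d >= 0] satisfies [A d = 0] and
    [c^T d < 0] ([dual_infeasible_ray]), and moving along [d] from any primal
    feasible point drives the objective to [-oo].  Farkas' lemma itself is
    proved algebraically, following Bartl, by induction on the number of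
    generators of the cone. *)

Lemma nonneg_dot (R : realType) (n : nat) (u v : 'cV[R]_n) :
  nonneg u -> nonneg v -> 0 <= (u^T *m v) 0 0.
Proof.
by move=> u0 v0; rewrite mxE; apply: sumr_ge0 => i _; rewrite mxE mulr_ge0.
Qed.

Lemma nonneg_col_mx (R : realType) (n1 n2 : nat)
    (u : 'cV[R]_n1) (v : 'cV[R]_n2) :
  nonneg (col_mx u v) <-> nonneg u /\ nonneg v.
Proof.
split=> [uv0|[u0 v0] i]; last by rewrite mxE; case: (fintype.split i).
by split=> i; [have := uv0 (lshift n2 i); rewrite col_mxEu
              |have := uv0 (rshift n1 i); rewrite col_mxEd].
Qed.

(** Bartl's induction.  If the last [k] generators [H] do not suffice, some
    [x] separates [c] from their cone, and the remaining generator [g] must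
    satisfy [g^T x < 0]; let [z] be [x] rescaled so that [g^T z = -1].  The
    projection [Q = 1 + g z^T] then kills [g], so it removes [g] from the
    hypothesis, and the induction hypothesis writes [Q c] as a nonnegative
    combination of the columns of [Q H].  Undoing [Q] only changes the coefficient of [g], which
    becomes [z^T H u - z^T c], and this is nonnegative because
    [H^T z >= 0] and [c^T z <= 0]. *)
Lemma farkas (R : realType) (n k : nat) (G : 'M[R]_(n, k)) (c : 'cV[R]_n) :
  (forall d : 'cV[R]_n, nonneg (G^T *m d) -> 0 <= (c^T *m d) 0 0) ->
  exists2 u : 'cV[R]_k, nonneg u & G *m u = c.
Proof.
elim: k G c => [|k IH] G c Gc.
  have c0 (d : 'cV[R]_n) : 0 <= (c^T *m d) 0 0 by apply: Gc => -[].
  exists 0; first by move=> i; rewrite mxE.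
  (* Without generators, [c] is nonnegative against every vector; testing it
     on a unit vector and on its opposite annihilates that coordinate. *)
  rewrite mulmx0; apply/matrixP => i j; rewrite ord1 mxE; apply/esym/eqP.
  rewrite eq_le; apply/andP; split.
    by have := c0 (- delta_mx i 0); rewrite mulmxN -colE !mxE oppr_ge0.
  by have := c0 (delta_mx i 0); rewrite -colE !mxE.
rewrite -[k.+1]/(1 + k)%N in G Gc *.
rewrite -(hsubmxK G) in Gc *.
move: (lsubmx G) (rsubmx G) Gc => g H Gc.
have {}Gc (d : 'cV[R]_n) : nonneg (g^T *m d) -> nonneg (H^T *m d) ->
    0 <= (c^T *m d) 0 0.
  by move=> gd Hd; apply: Gc; rewrite tr_row_mx mul_col_mx; apply/nonneg_col_mx.
have [Hc|/existsNP[x /not_implyP[Hx /negP]]] :=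
    pselect (forall d : 'cV[R]_n, nonneg (H^T *m d) -> 0 <= (c^T *m d) 0 0).
  have [u u0 Hu] := IH H c Hc; exists (col_mx 0 u).
    by apply/nonneg_col_mx; split=> // i; rewrite mxE.
  by rewrite mul_row_col mulmx0 add0r.
rewrite -ltNge => cx.
have gx : (g^T *m x) 0 0 < 0.
  rewrite ltNge; apply/negP => gx; move: cx; rewrite ltNge => /negP; apply.
  by apply: Gc => // i; rewrite !ord1.
have t0 : 0 < - (g^T *m x) 0 0 by rewrite oppr_gt0.
move: t0; set t := - _ => t0.
have [z [Hz cz gz]] : exists z : 'cV[R]_n,
    [/\ nonneg (H^T *m z), (c^T *m z) 0 0 <= 0 & g^T *m z = - 1%:M].
  exists (t^-1 *: x); split.
  - by move=> i; rewrite -scalemxAr mxE mulr_ge0 // invr_ge0 ltW.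
  - by rewrite -scalemxAr mxE mulr_ge0_le0 ?invr_ge0 ?ltW.
  - rewrite -scalemxAr [g^T *m x]mx11_scalar -[_ 0 0]opprK -/t.
    by rewrite scale_scalar_mx mulrN mulVf ?gt_eqF// raddfN.
pose Q := 1%:M + g *m z^T.
have Qg : g^T *m Q^T = 0.
  rewrite raddfD /= trmx1 trmx_mul trmxK mulmxDr mulmx1 mulmxA gz mulNmx.
  by rewrite mul1mx subrr.
have [d Hd|u u0 Qu] := IH (Q *m H) (Q *m c).
  rewrite trmx_mul -mulmxA; apply: Gc; last by rewrite mulmxA -trmx_mul.
  by move=> i; rewrite mulmxA Qg mul0mx mxE.
exists (col_mx (z^T *m H *m u - z^T *m c) u).
  apply/nonneg_col_mx; split=> // i; rewrite !ord1 [leRHS]mxE [X in _ + X]mxE.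
  rewrite addr_ge0 ?oppr_ge0 //.
    by have := nonneg_dot _ _ _ _ Hz u0; rewrite trmx_mul trmxK.
  by rewrite -[z^T *m c]trmxK trmx_mul trmxK mxE.
move: Qu; rewrite mul_row_col /Q !mulmxDl !mul1mx -!mulmxA => Qu.
rewrite mulmxBr addrAC [_ + H *m u]addrC Qu; exact: addrK.
Qed.

(** Dual feasibility says that [c] lies in the cone generated by the columns
    of [A^T], those of [- A^T] (the variable [y] is free in sign) and the unit
    vectors (the slack [s]). *)
Lemma dual_infeasible_ray (R : realType) (m n : nat) (A : 'M[R]_(m, n))
    (chat c : 'cV[R]_n) :
  ~ (dual_feasible A chat c !=set0) ->
  exists d : 'cV[R]_n, [/\ nonneg d, A *m d = 0 & objective chat c d < 0].
Proof.
move=> D0; apply: contrapT => noray; apply: D0.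
have [d|u] := @farkas R n (m + (m + n))
    (row_mx A^T (row_mx (- A^T) 1%:M)) (chat + c).
  rewrite !tr_row_mx !mul_col_mx raddfN /= trmxK trmx1 mul1mx mulNmx.
  move=> /nonneg_col_mx[Ad /nonneg_col_mx[NAd d0]].
  rewrite leNgt; apply/negP => cd; apply: noray; exists d; split=> //.
  apply/matrixP => i j; rewrite ord1 [RHS]mxE; apply/eqP; rewrite eq_le Ad andbT.
  by have := NAd i; rewrite [leRHS]mxE oppr_ge0.
rewrite -[u]vsubmxK -[dsubmx u]vsubmxK.
move=> /nonneg_col_mx[_ /nonneg_col_mx[_ s0]].
rewrite !mul_row_col mul1mx mulNmx addrA -mulmxBr => Aus.
by exists (usubmx u - usubmx (dsubmx u), dsubmx (dsubmx u)); split.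
Qed.

Lemma opt_value_dual_infeasible (R : realType) (m n : nat) (A : 'M[R]_(m, n))
    (bhat b : 'cV[R]_m) (chat c : 'cV[R]_n) :
  primal_feasible A bhat b !=set0 -> ~ (dual_feasible A chat c !=set0) ->
  opt_value A bhat chat b c = -oo%E.
Proof.
move=> [x [Ax x0]] /dual_infeasible_ray[d [d0 Ad cd]].
apply: opt_value_unbounded => M.
set r := objective chat c x; set e := objective chat c d in cd.
(* The step length brings the objective down to [r - (|r - M| + 1) < M]. *)
pose t := (`|r - M| + 1) / - e.
have t0 : 0 <= t by rewrite divr_ge0 ?addr_ge0 // oppr_ge0 ltW.
exists (x + t *: d).
  split; first by rewrite mulmxDr -scalemxAr Ad scaler0 addr0.
  by move=> i; rewrite !mxE addr_ge0 // mulr_ge0.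
have -> : objective chat c (x + t *: d) = r + t * e.
  by rewrite /objective mulmxDr -scalemxAr [LHS]mxE [X in _ + X]mxE.
have -> : t * e = - (`|r - M| + 1).
  by rewrite /t invrN mulrN mulNr divfK // lt_eqF.
have := ler_norm (r - M); lra.
Qed.

Theorem proposition4 (R : realType) (m n : nat) (A : 'M[R]_(m, n))
    (bhat : 'cV[R]_m) (chat : 'cV[R]_n)
    (U : set ('cV[R]_m * 'cV[R]_n))
    (U_compact : compact U) (U_convex : convex_set U) (U0 : U (0, 0))
    (P0_neq0 : primal_feasible A bhat 0 !=set0)
    (D0_neq0 : dual_feasible A chat 0 !=set0)
    (P0_or_D0_bounded : bounded_set (primal_feasible A bhat 0) \/
                        bounded_set (dual_feasible A chat 0)) :
  let Ubar := restricted_uncertainty A bhat chat U in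
  let p_minus := inf_opt_value A bhat chat U in
  let p_plus := sup_opt_value A bhat chat U in
  let q_minus := inf_opt_value A bhat chat Ubar in
  let q_plus := sup_opt_value A bhat chat Ubar in
  (p_plus \is a fin_num -> q_plus = p_plus) /\
  (p_minus \is a fin_num -> q_minus = p_minus).
Proof.
move=> Ubar p_minus p_plus q_minus q_plus.
have UbarU : Ubar `<=` U by move=> bc [].
split=> p_fin; apply/eqP; rewrite eq_le; apply/andP; split.
- by apply: le_ereal_sup; exact: image_subset.
- apply: ge_ereal_sup => _ [bc Ubc <-].
  have [P|/set0P/negP] := pselect (primal_feasible A bhat bc.1 !=set0).
    have [D|D] := pselect (dual_feasible A chat bc.2 !=set0).
      by apply: ereal_sup_ubound; exists bc.
    by rewrite opt_value_dual_infeasible // leNye.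
  rewrite negbK => /eqP P0.
  have : (opt_value A bhat chat bc.1 bc.2 <= p_plus)%E.
    by apply: ereal_sup_ubound; exists bc.
  by rewrite opt_value_infeasible // leye_eq => /eqP p_oo; rewrite p_oo in p_fin.
- apply: le_ereal_inf_tmp => _ [bc Ubc <-].
  have [P|/set0P/negP] := pselect (primal_feasible A bhat bc.1 !=set0); last first.
    by rewrite negbK => /eqP P0; rewrite opt_value_infeasible // leey.
  have [D|D] := pselect (dual_feasible A chat bc.2 !=set0).
    by apply: ereal_inf_lbound; exists bc.
  have : (p_minus <= opt_value A bhat chat bc.1 bc.2)%E.
    by apply: ereal_inf_lbound; exists bc.
  by rewrite opt_value_dual_infeasible // leeNy_eq => /eqP p_oo; rewrite p_oo in p_fin.
- by apply: ereal_inf_le_tmp; exact: image_subset.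
Qed.
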